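(* Let $G$ be a finitely generated group acting acylindrically on a hyperbolic space $Y$ and let $g_1,\ldots,g_k,u_1,\ldots,u_k\in G$ be such that each $u_i$ is loxodromic. For each $1\le i\le k$, assume $$\langle u_i\rangle\cap g_{i+1}\langle u_{i+1}\rangle g_{i+1}^{-1}=\{1\},$$ where the indices are taken modulo $k$. For $t=(t_1,\ldots,t_k)\in\mathbb{Z}^k$, define $$\phi(t)=g_1u_1^{t_1}g_2u_2^{t_2}\cdots g_ku_k^{t_k}.$$ Then $\phi(t)$ is loxodromic whenever all $|t_i|$ are sufficiently large; that is, there is $M>0$ such that $\phi(t)$ is loxodromic whenever $|t_i|\ge M$ for every $i$.
   Context: An isometric action of a non-virtually-cyclic group $G$ on a metric space $(Y,d)$ is acylindrical if for all $r\ge0$ there exist $R,N\ge0$ such that whenever $x,y\in Y$ satisfy $d(x,y)\ge R$, the set $\{g\in G: d(x,gx)\le r\text{ and }d(y,gy)\le r\}$ has cardinality at most $N$. A hyperbolic space is a Gromov-hyperbolic (geodesic) metric space. An element $g\in G$ is loxodromic if it acts by translation on a quasi-geodesic axis in $Y$. *)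

(* Defs.v *)
From mathcomp Require Import all_boot all_order all_algebra.
From mathcomp Require Import all_classical all_reals topology.

Set Implicit Arguments.
Unset Strict Implicit.
Unset Printing Implicit Defensive.

Import Order.TTheory GRing.Theory Num.Theory.

Local Open Scope classical_set_scope.
Local Open Scope ring_scope.

Section Groups.
Variable G : groupType.
Implicit Types (x g u : G) (A H : set G).

Definition expgz x (n : int) : G :=
  match n with
  | Posz m => (x ^+ m)%g
  | Negz m => (x ^- m.+1)%g
  end.

Definition subgroup H := H 1%g /\ forall x y, H x -> H y -> H (x * y^-1)%g.

Definition generated_subgroup A : set G := smallest subgroup A.

Definition cyclic_subgroup u : set G := range (expgz u).

Definition lcoset_set g H : set G := [set (g * h)%g | h in H].

(* In MathComp [x ^ g] is [g^-1 * x * g], so this is [H] conjugated by [g^-1]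
   in that convention. *)
Definition conj_set g H : set G := [set (g * h * g^-1)%g | h in H].

Definition finite_index H := finite_set [set lcoset_set g H | g in [set: G]].

End Groups.

Definition finitely_generated (G : groupType) :=
  exists s : seq G, generated_subgroup [set` s] = [set: G].

(* Finite groups are virtually cyclic: take [a = 1]. *)
Definition virtually_cyclic (G : groupType) :=
  exists a : G, finite_index (cyclic_subgroup a).

Section MetricSpaces.
Variables (R : realType) (Y : metricType R).
Implicit Types (x y z w : Y) (gamma : R -> Y).

Definition geodesic_segment x y gamma :=
  [/\ gamma 0 = x, gamma (mdist x y) = y &
      {in `[0, mdist x y] &, forall s t, mdist (gamma s) (gamma t) = `|s - t|}].

Definition geodesic_space := forall x y, exists gamma, geodesic_segment x y gamma.

Definition gromov_product w x y : R :=
  (mdist x w + mdist y w - mdist x y) / 2.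

Definition gromov_hyperbolic := exists delta : R, 0 <= delta /\
  forall w x y z,
    Num.min (gromov_product w x y) (gromov_product w y z) - delta
      <= gromov_product w x z.

Definition hyperbolic_space := geodesic_space /\ gromov_hyperbolic.

(* As usual in coarse geometry, no continuity is required. *)
Definition quasi_geodesic gamma := exists lambda c : R,
  [/\ 1 <= lambda, 0 <= c &
      forall s t, lambda^-1 * `|s - t| - c <= mdist (gamma s) (gamma t)
                  /\ mdist (gamma s) (gamma t) <= lambda * `|s - t| + c].

End MetricSpaces.

Arguments geodesic_space {R} Y.
Arguments gromov_hyperbolic {R} Y.
Arguments hyperbolic_space {R} Y.

Section Actions.
Variables (R : realType) (Y : metricType R) (G : groupType).
Variable act : G -> Y -> Y.

Definition isometric_action :=
  [/\ forall y, act 1%g y = y,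
      forall g h y, act (g * h)%g y = act g (act h y) &
      forall g x y, mdist (act g x) (act g y) = mdist x y].

Definition acylindrical := forall r : R, 0 <= r ->
  exists (D : R) (N : nat), 0 <= D /\
    forall x y : Y, D <= mdist x y ->
      ([set g : G | mdist x (act g x) <= r /\ mdist y (act g y) <= r]
         #<= `I_N)%card.

(* The translation length [tau] is nonzero, so the identity is excluded; its
   sign is immaterial since the axis can be reversed. *)
Definition loxodromic (g : G) := exists (gamma : R -> Y) (tau : R),
  [/\ quasi_geodesic gamma, tau != 0 &
      forall s, act g (gamma s) = gamma (s + tau)].

End Actions.

(* [k] factors, indexed from [0] to [k - 1], multiplied in increasing order. *)
Definition phi (G : groupType) (k : nat) (g u : 'I_k -> G) (t : 'I_k -> int) : G :=
  (\prod_(i < k) (g i * expgz (u i) (t i)))%g.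

(* Main.v *)
Require Import Defs.
From mathcomp Require Import all_boot all_order all_algebra.
From mathcomp Require Import all_classical all_reals topology.
From mathcomp Require Import lra zify.

(** Fix a base point [o] and consider, for [w = phi g u t], the broken path
    through the images of [o] under the successive partial products of the
    periodic word [w w w ...].  Its sides have the lengths
    [d(o, g_i u_i^(t_i) o)], which are large when the [|t_i|] are.  Suppose
    that the Gromov product at each corner is at most [C], a constant that does
    not depend on [t].  In a [delta]-hyperbolic space a broken path whose sides
    are long compared with [C + delta] never turns back, so its distance to
    [o] grows at least linearly ([local_to_global]).  Thus
    [d(o, w^n o) >= n] for all [n], and [s |-> w^(floor s) o] is a quasi-axis
    of [w] ([drift_loxodromic]).

    Up to bounded errors the corner between the sides [i] and [i + 1] is the
    Gromov product at [o] of [a^z o] and [b^z' o], where [a = u_i] and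
    [b = g_(i+1) u_(i+1) g_(i+1)^-1] are loxodromic and generate subgroups
    with trivial intersection.  So the heart of the matter is that these
    products are bounded ([axes_diverge]).  If one of them is huge, then the
    orbits of [a] and [b] fellow-travel for a long time: [a^i o] is close to
    [b^(j i) o] for all [i] up to a large bound.  The elements
    [b^-(j i) a^i] then move by a bounded amount both [o] and a far away point
    [a^P o].  By acylindricity two of them coincide, which gives a nontrivial
    power of [a] in the group generated by [b].

    The fellow-travelling argument needs precise information on the orbit of
    a loxodromic element: [d(o, a^n o)] differs from a linear function [L n]
    by a bounded amount ([orbit_linear]).  The excess
    [e n = d(o, a^n o) - L n], with [L] the stable translation length, is
    sublinear by subadditivity, whereas the four point condition shows that
    once [e] exceeds a certain threshold it about doubles when [n] does, which
    would make it grow linearly. *)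

Set Implicit Arguments.
Unset Strict Implicit.
Unset Printing Implicit Defensive.

Import Order.TTheory GRing.Theory Num.Theory.

Local Open Scope classical_set_scope.
Local Open Scope ring_scope.

(** * Subadditive sequences and uniform constants *)

(** Makes the constants of the proof independent of the index; upward closed
    conditions allow the maximum of the individual constants. *)
Lemma uniform_bound (R : realType) (I : finType) (P : I -> R -> Prop) :
    (forall i C C', C <= C' -> P i C -> P i C') ->
    (forall i, exists C, P i C) -> exists2 C, 0 <= C & forall i, P i C.
Proof.
move=> Pmono /choice[C PC]; exists (\big[Num.max/0]_i C i).
  exact: bigmax_ge_id.
by move=> i; apply: Pmono (PC i); exact: le_bigmax.
Qed.

Section SubadditiveSequences.
Variable R : realType.
Implicit Types (f e : nat -> R) (c delta A B : R).

Lemma subadditive_mul f n : (forall p q, f (p + q)%N <= f p + f q) ->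
  forall j r, f (j * n + r)%N <= j%:R * f n + f r.
Proof.
move=> fD j r; elim: j => [|j IHj]; first by rewrite mul0n mul0r add0n add0r.
by have := fD n (j * n + r)%N; rewrite mulSn addnA -natr1; lra.
Qed.

Lemma bounded_on_initial_segment e n : exists B, forall i, (i < n)%N -> e i <= B.
Proof.
elim: n => [|n [B eB]]; first by exists 0.
exists (Num.max B (e n)) => i; rewrite ltnS leq_eqVlt le_max => /orP[/eqP->|/eB->//].
by rewrite lexx orbT.
Qed.

(** Fekete's lemma with [L := inf_n f n / n]: dividing with remainder by an [n]
    that nearly realizes the infimum shows that the excess of [f] over the line
    of slope [L] is sublinear. *)
Lemma subadditive_rate f c : 0 < c -> (forall n, c * n%:R <= f n) ->
    (forall p q, f (p + q)%N <= f p + f q) ->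
  exists L, [/\ 0 < L, forall n, L * n%:R <= f n &
    forall eps, 0 < eps -> exists B, forall n, f n <= (L + eps) * n%:R + B].
Proof.
move=> c0 fc fD.
pose S := [set f n.+1 / n.+1%:R | n in [set: nat]].
have Slb : lbound S c.
  by move=> _ [n _ <-]; rewrite ler_pdivlMr ?ltr0n.
have Snt : S !=set0 by exists (f 1%N / 1%:R); exists 0%N.
have Sinf : has_inf S by split => //; exists c.
have L0 : c <= inf S by exact: lb_le_inf.
exists (inf S); split=> [|[|n]|eps eps0]; first exact: lt_le_trans L0.
- by have := fc 0%N; rewrite !mulr0.
- by rewrite -ler_pdivlMr ?ltr0n //; apply: ge_inf; [exists c | exists n].
have [_ [n _ <-]] := inf_adherent eps0 Sinf.
rewrite ltr_pdivrMr ?ltr0n // => fn.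
have [B fB] := bounded_on_initial_segment f n.+1; exists B => m.
rewrite {1 2}(divn_eq m n.+1) natrD mulrDr.
have := subadditive_mul n.+1 fD (m %/ n.+1) (m %% n.+1).
have := fB _ (ltn_pmod m (ltn0Sn n)).
have : (m %/ n.+1)%:R * f n.+1 <= (m %/ n.+1)%:R * ((inf S + eps) * n.+1%:R).
  by rewrite ler_wpM2l ?ler0n // ltW.
have : 0 <= (inf S + eps) * (m %% n.+1)%:R.
  by rewrite mulr_ge0 ?ler0n //; lra.
rewrite natrM; lra.
Qed.

(** A single value above [B] starts an iteration in which [e - A] doubles while
    the argument at most doubles, so [e] grows linearly along a sequence. *)
Lemma sublinear_doubling_bounded e A B : A <= B ->
    (forall n, B < e n -> exists2 m, (m <= 2 * n)%N & 2 * (e n - A) <= e m - A) ->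
    (forall eps, 0 < eps -> exists C, forall n, e n <= eps * n%:R + C) ->
  forall n, e n <= B.
Proof.
move=> AB e2 esub n; rewrite leNgt; apply/negP => Ben.
have n0 : 0 < n.+1%:R :> R by rewrite ltr0n.
pose eta := e n - A; have eta0 : 0 < eta by rewrite /eta; lra.
have grow j : exists2 m, (m <= 2 ^ j * n)%N & (2 ^ j)%:R * eta <= e m - A.
  elim: j => [|j [m mn em]]; first by exists n; rewrite ?mul1n ?mul1r.
  have /e2[m' m'm em'] : B < e m.
    have : 1 * eta <= (2 ^ j)%:R * eta by rewrite ler_pM2r // ler1n expn_gt0.
    by rewrite /eta in em *; lra.
  exists m'; first by rewrite expnS -mulnA; lia.
  by rewrite expnS natrM; lra.
clearbody eta; have [|C eC] := esub (eta / 2 / n.+1%:R); first by rewrite !divr_gt0.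
have [m mn em] := grow (Num.bound ((C - A) * 2 / eta)).
have := upper_nthrootP (leqnn (Num.bound ((C - A) * 2 / eta))).
rewrite -natrX; set j := Num.bound _ in mn em *; rewrite ltr_pdivrMr // => jlt.
have : eta / 2 / n.+1%:R * m%:R <= eta / 2 * (2 ^ j)%:R.
  rewrite -[leLHS]mulrA ler_pM2l ?divr_gt0 // mulrC ler_pdivrMr // -natrM ler_nat.
  by apply: leq_trans mn _; rewrite leq_mul.
move: (eC m) em jlt; move: (_ * m%:R) (2 ^ j)%:R => y z; lra.
Qed.

Lemma argmax_initial_segment e n :
  exists2 m, (m <= n)%N & forall i, (i <= n)%N -> e i <= e m.
Proof.
case: (@arg_maxP _ _ 'I_n.+1 ord0 xpredT e) => // i _ ei.
exists i => [|j jn]; first exact: leq_ord.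
by have := ei (inord j) isT; rewrite inordK.
Qed.

(** The last hypothesis is the four point condition for the points of an orbit
    with exponents [0], [p], [p + q] and [p + q + p].  Take [L] to be the limit
    slope of [f], and fix [q] with [L q > delta].  If the excess
    [e n = f n - L n] is maximal on an initial segment at [p + q], then
    [f (p + q)] exceeds [f p] by more than [delta], so the maximum in the
    hypothesis is its second term; this reads
    [e (p + q + p) >= 2 e (p + q) - const], the doubling that a sublinear
    sequence cannot sustain. *)
Lemma linear_up_to_constant f c delta : 0 < c -> 0 <= delta ->
    (forall n, c * n%:R <= f n) ->
    (forall p q, f (p + q)%N <= f p + f q) ->
    (forall p q, 2 * f (p + q)%N <=
       Num.max (2 * f p) (f q + f (p + q + p)%N) + 2 * delta) ->
  exists L E, [/\ 0 < L, 0 <= E & forall n, L * n%:R <= f n <= L * n%:R + E].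
Proof.
move=> c0 delta0 fc fD f4.
have [L [L0 fL fsub]] := subadditive_rate c0 fc fD.
pose e n := f n - L * n%:R.
have e0 n : 0 <= e n by rewrite /e subr_ge0.
(* With this choice of [q] the first term of the maximum is too small. *)
pose q := (Num.bound (delta / L)).+1.
have Lq : delta < L * q%:R.
  rewrite mulrC -ltr_pdivrMr // /q -natr1.
  by have := archi_boundP (divr_ge0 delta0 (ltW L0)); lra.
clearbody q; have [B eB] := bounded_on_initial_segment e q.
pose A := e q + 2 * delta.
have fe n : f n = L * n%:R + e n by rewrite /e; lra.
suff eAB n : e n <= Num.max A B.
  exists L, (Num.max A B); split=> // [|n]; first exact: le_trans (eAB 0%N).
  by rewrite fL /= fe lerD2l.
apply: (@sublinear_doubling_bounded e A) n => [|n|eps eps0].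
- by rewrite le_max lexx.
  (* The doubling starts from the maximum [m] of [e] up to [n], so that
     [e p <= e m] for [p = m - q]; here [q <= m] because [e m > B], while [B]
     bounds [e] below [q]. *)
- have [m mn em] := argmax_initial_segment e n; rewrite gt_max => /andP[An Bn].
  have qm : (q <= m)%N.
    by rewrite leqNgt; apply/negP => /eB; have := em n (leqnn n); lra.
  have [p mE] : exists p, m = (p + q)%N by exists (m - q)%N; rewrite subnK.
  exists (p + q + p)%N; first by lia.
  have := f4 p q; rewrite !fe -mE !natrD.
  have : e p <= e m by apply: em; lia.
  have := em n (leqnn n); rewrite mE !natrD /A.
  by rewrite maxEle; case: ifP => _; lra.
- by have [C fC] := fsub eps eps0; exists C => n; have := fC n; rewrite /e; lra.
Qed.
(** Applying the hypothesis to the multiples [j n] and dividing by [j] makes the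
    additive constant disappear. *)
Lemma subadditive_linear_lb f c C :
    (forall p q, f (p + q)%N <= f p + f q) ->
    (forall n, c * n%:R - C <= f n) -> forall n, c * n%:R <= f n.
Proof.
move=> fD fc n; rewrite leNgt; apply/negP; rewrite -subr_gt0 => gap.
have := archi_boundP (normr_ge0 ((C + f 0%N) / (c * n%:R - f n))).
set j := Num.bound _ => /(le_lt_trans (ler_norm _)).
rewrite ltr_pdivrMr // => jlt.
have := subadditive_mul n fD j 0%N; have := fc (j * n)%N.
by rewrite addn0 natrM; lra.
Qed.

End SubadditiveSequences.

(** * Integer powers in a group *)

Section IntegerPowers.
Variable G : groupType.
Implicit Types (a g : G) (z : int).

(** Lets statements about powers with integer exponents be reduced to natural
    exponents, applied to [a] or to its inverse. *)
Definition signed a (s : bool) : G := if s then a^-1%g else a.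

Lemma expgzE a z : expgz a z = (signed a (z < 0) ^+ `|z|%N)%g.
Proof. by case: z => n //=; rewrite expVgn. Qed.

Lemma signed_expgz a s (n : nat) : (signed a s ^+ n)%g = expgz a ((-1) ^+ s * n%:Z).
Proof.
case: s; last by rewrite /= mul1n.
by rewrite expr1 mulN1r; case: n => [|n]; rewrite ?expg0 //= expVgn.
Qed.

Lemma expgzN a z : expgz a (- z) = ((expgz a z)^-1)%g.
Proof. by case: z => [[|n]|n] /=; rewrite ?expg0 ?invg1 ?invgK. Qed.

Lemma expgz_succ a z : expgz a (z + 1) = (expgz a z * a)%g.
Proof.
case: z => n; first by rewrite addrC /= expgSr.
case: n => [|n].
  by rewrite /= expg1 mulVg.
have -> : Negz n.+1 + 1 = Negz n by rewrite !NegzE; lia.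
by rewrite /= -!expVgn [in RHS]expgSr -mulgA mulVg mulg1.
Qed.

Lemma expgzDn a z (n : nat) : expgz a (z + n%:Z) = (expgz a z * a ^+ n)%g.
Proof.
elim: n => [|n IHn]; first by rewrite addr0 expg0 mulg1.
have -> : z + n.+1%:Z = z + n%:Z + 1 by lia.
by rewrite expgz_succ IHn -mulgA expgSr.
Qed.

Lemma expgz_succl a z : expgz a (1 + z) = (a * expgz a z)%g.
Proof.
case: z => n; first by rewrite /= expgS.
have -> : 1 + Negz n = - n%:Z by rewrite NegzE; lia.
rewrite /= -expVgn expgS mulgA mulgV mul1g.
by rewrite -mulN1r -[-1]expr1 -(signed_expgz a true).
Qed.

Lemma conj_expg g a n : ((g * a * g^-1) ^+ n = g * a ^+ n * g^-1)%g.
Proof.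
elim: n => [|n IHn]; first by rewrite !expg0 mulg1 mulgV.
by rewrite !expgS IHn !mulgA mulgVK.
Qed.

Lemma conj_expgz g a z : expgz (g * a * g^-1)%g z = (g * expgz a z * g^-1)%g.
Proof. by case: z => n /=; rewrite conj_expg // !invgM invgK mulgA. Qed.

Lemma conj_cyclic_subgroup g a :
  conj_set g (cyclic_subgroup a) = cyclic_subgroup (g * a * g^-1)%g.
Proof.
apply/seteqP; split => [_ [_ [z _ <-] <-]|_ [z _ <-]].
  by exists z; rewrite ?conj_expgz.
by exists (expgz a z); [exists z | rewrite conj_expgz].
Qed.

End IntegerPowers.

(** * Gromov products and broken paths *)

Section GromovProducts.
Variables (R : realType) (Y : metricType R).
Implicit Types (o w x y z : Y) (delta C : R).

Lemma gromov_productC w x y : gromov_product w x y = gromov_product w y x.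
Proof. by rewrite /gromov_product [mdist y x]metric_sym; lra. Qed.

Lemma gromov_product_ge0 w x y : 0 <= gromov_product w x y.
Proof.
rewrite /gromov_product; have := metric_triangle x w y.
by rewrite [mdist w y]metric_sym; lra.
Qed.

Lemma gromov_product_lel w x y : gromov_product w x y <= mdist x w.
Proof.
rewrite /gromov_product; have := metric_triangle y x w.
by rewrite [mdist y x]metric_sym; lra.
Qed.

Lemma gromov_product_ler w x y : gromov_product w x y <= mdist y w.
Proof. by rewrite gromov_productC gromov_product_lel. Qed.

Lemma gromov_product_movel w x x' y :
  gromov_product w x y <= gromov_product w x' y + mdist x x'.
Proof.
rewrite /gromov_product; have := metric_triangle x x' w.
by have := metric_triangle x' x y; rewrite [mdist x' x]metric_sym; lra.
Qed.

Lemma gromov_product_mover w x y y' :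
  gromov_product w x y <= gromov_product w x y' + mdist y y'.
Proof. by rewrite !(gromov_productC w x) gromov_product_movel. Qed.

Definition hyperbolic_with delta := forall w x y z,
  Num.min (gromov_product w x y) (gromov_product w y z) - delta
    <= gromov_product w (x : Y) z.

Lemma hyperbolic_with_ge0 o delta : hyperbolic_with delta -> 0 <= delta.
Proof. by move=> /(_ o o o o); rewrite minxx lerBlDr lerDl. Qed.

(** Clearing denominators in the definition of Gromov products makes the base
    point drop out: the inequality is symmetric in the four points. *)
Lemma four_point delta : hyperbolic_with delta -> forall w x y z,
  mdist w y + mdist x z <=
    Num.max (mdist w x + mdist y z) (mdist x y + mdist w z) + 2 * delta.
Proof.
move=> hyp w x y z; have := hyp w x y z; rewrite /gromov_product !(metric_sym _ w).
rewrite minEle -lerBlDr le_max.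
by case: ifP => _ ?; apply/orP; [right | left]; lra.
Qed.

(** The product of [x 0] and [x n.+1] seen from [x n] stays below [C + delta]:
    the next side being long, [x 0] and [x n] have a large product seen from
    [x n.+1], so hyperbolicity transfers to [x 0] the bound [C] on the corner
    at [x n.+1], at the cost of one [delta].  Each step therefore increases the
    distance to [x 0] by at least [1]. *)
Lemma local_to_global delta C (x : nat -> Y) : hyperbolic_with delta ->
    (forall n, gromov_product (x n.+1) (x n) (x n.+2) <= C) ->
    (forall n, 2 * (C + delta) + 1 <= mdist (x n) (x n.+1)) ->
  forall n, n%:R <= mdist (x 0%N) (x n).
Proof.
move=> hyp xC xd.
have straight n : gromov_product (x n) (x 0%N) (x n.+1) <= C + delta.
  elim: n => [|n IHn].
    rewrite /gromov_product mdistxx [mdist (x 1%N) _]metric_sym add0r subrr mul0r.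
    rewrite addr_ge0 ?(hyperbolic_with_ge0 (x 0%N) hyp) //.
    by rewrite (le_trans _ (xC 0%N)) ?gromov_product_ge0.
  have := hyp (x n.+1) (x n) (x 0%N) (x n.+2).
  have := xC n; have := xd n.
  move: IHn; rewrite /gromov_product [mdist (x n) (x 0%N)]metric_sym.
  rewrite [mdist (x n.+1) (x n)]metric_sym.
  by rewrite minEle; case: ifP => _; lra.
elim=> [|n IHn]; first exact: mdist_ge0.
have := straight n; have := xd n; rewrite /gromov_product -[n.+1%:R]natr1.
by rewrite [mdist (x n.+1) (x n)]metric_sym; lra.
Qed.

End GromovProducts.

(** * Loxodromic elements and growth of orbits *)

Section IsometricActions.
Variables (R : realType) (Y : metricType R) (G : groupType).
Variable act : G -> Y -> Y.
Hypothesis isom_act : isometric_action act.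
Implicit Types (a b g w : G) (o y : Y) (c delta : R).

Lemma act1 y : act 1%g y = y. Proof. by case: isom_act. Qed.

Lemma actM g h y : act (g * h)%g y = act g (act h y).
Proof. by case: isom_act. Qed.

Lemma mdist_act g x y : mdist (act g x) (act g y) = mdist x y.
Proof. by case: isom_act. Qed.

Lemma mdist_actV g x y : mdist x (act g^-1%g y) = mdist (act g x) y.
Proof. by rewrite -(mdist_act g) -actM mulgV act1. Qed.

Lemma gromov_product_act g o x y :
  gromov_product (act g o) (act g x) (act g y) = gromov_product o x y.
Proof. by rewrite /gromov_product !mdist_act. Qed.

(** A positive drift rate is the form in which loxodromicity is used.  Requiring
    the bound at every point [y], without an additive constant, makes it
    invariant under conjugation. *)
Definition drift_rate c a := forall y n, c * n%:R <= mdist y (act (a ^+ n)%g y).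

Lemma orbit_dist a o m n :
  mdist (act (a ^+ m)%g o) (act (a ^+ (m + n))%g o) = mdist o (act (a ^+ n)%g o).
Proof. by rewrite expgnDr actM mdist_act. Qed.

Lemma orbit_subadditive a o p q :
  mdist o (act (a ^+ (p + q))%g o) <=
    mdist o (act (a ^+ p)%g o) + mdist o (act (a ^+ q)%g o).
Proof.
by rewrite -(orbit_dist a o p q) metric_triangle.
Qed.

Lemma orbit_le_mul a o n : mdist o (act (a ^+ n)%g o) <= n%:R * mdist o (act a o).
Proof.
have := subadditive_mul 1 (orbit_subadditive a o) n 0.
by rewrite addn0 muln1 expg1 expg0 act1 mdistxx addr0.
Qed.

Lemma drift_rate_signed c a s : drift_rate c a -> drift_rate c (signed a s).
Proof.
case: s => // ac y n.
by rewrite /signed expVgn mdist_actV metric_sym ac.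
Qed.

Lemma drift_rate_conj c a g : drift_rate c a -> drift_rate c (g * a * g^-1)%g.
Proof.
move=> ac y n; rewrite conj_expg -mulgA actM -{1}[g]invgK.
by rewrite [X in _ <= X]metric_sym -mdist_actV invgK actM metric_sym ac.
Qed.

Lemma drift_rate_expgz c a z y :
  drift_rate c a -> c * `|z|%:~R <= mdist y (act (expgz a z) y).
Proof.
by move=> ac; rewrite expgzE -[`|z|]abszE; exact: drift_rate_signed.
Qed.

(** Changing the base point only costs an additive constant, which subadditivity
    then removes. *)
Lemma drift_rate_of_orbit c C a o :
  (forall n, c * n%:R - C <= mdist o (act (a ^+ n)%g o)) -> drift_rate c a.
Proof.
move=> ac y; apply: (@subadditive_linear_lb _ _ _ (C + 2 * mdist y o)).
  exact: orbit_subadditive.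
move=> n; have := ac n; have := metric_triangle o y (act (a ^+ n)%g o).
have := metric_triangle y (act (a ^+ n)%g y) (act (a ^+ n)%g o).
by rewrite mdist_act [mdist o y]metric_sym; lra.
Qed.

Lemma loxodromic_drift a : loxodromic act a -> exists2 c, 0 < c & drift_rate c a.
Proof.
move=> [gamma [tau [[l [C [l1 C0 gammaP]] tau0 agamma]]]].
have l0 : 0 < l by lra.
exists (l^-1 * `|tau|); first by rewrite mulr_gt0 ?invr_gt0 ?normr_gt0.
apply: (@drift_rate_of_orbit _ C _ (gamma 0)) => n.
have -> : act (a ^+ n)%g (gamma 0) = gamma (n%:R * tau).
  elim: n => [|n IHn]; first by rewrite expg0 act1 mul0r.
  by rewrite expgS actM IHn agamma -[n.+1%:R]natr1 mulrDl mul1r.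
have [+ _] := gammaP 0 (n%:R * tau).
by rewrite sub0r normrN normrM normr_nat; lra.
Qed.

(** The quasi-axis is [s |-> a^(floor s) o]; rounding costs an additive
    constant, and [d(o, a o)] bounds the speed from above. *)
Lemma drift_loxodromic c a o : 0 < c -> drift_rate c a -> loxodromic act a.
Proof.
move=> c0 ac; exists (fun s => act (expgz a (Num.floor s)) o), 1.
split=> [||s]; last 2 first.
- exact: oner_neq0.
- by rewrite floorDrz ?rpred1 // floor1 addrC expgz_succl actM.
pose D := mdist o (act a o).
have D0 : 0 <= D := mdist_ge0 _ _.
have near_linear i j : c * `|i - j|%:~R
      <= mdist (act (expgz a i) o) (act (expgz a j) o) <= D * `|i - j|%:~R.
  wlog ij : i j / i <= j.
    move=> W; case: (leP i j) => [/W//|/ltW/W].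
    by rewrite distrC [mdist (act (expgz a i) o) _]metric_sym.
  have [n ->] : exists n : nat, j = i + n%:Z by exists `|j - i|%N; lia.
  rewrite expgzDn actM mdist_act opprD addrA subrr sub0r normrN.
  by rewrite [_%:~R](_ : _ = n%:R :> R) // ac mulrC orbit_le_mul.
exists (D + c^-1 + 1), (D + c^-1 + 1).
have cV0 : 0 < c^-1 by rewrite invr_gt0.
split=> [||s t]; [lra|lra|].
have /andP[] := near_linear (Num.floor s) (Num.floor t).
set d := mdist _ _; set S := `|s - t|; set m : R := _%:~R => lo hi.
have : `|m - S| <= 1.
  rewrite /m intr_norm rmorphB (le_trans (ler_dist_dist _ _)) // ler_norml.
  by have := floor_itv s; have := floor_itv t; rewrite !intrD; lra.
rewrite ler_norml => /andP[mS Sm].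
have S0 : 0 <= S by exact: normr_ge0.
have cD : c <= D by have := ac o 1%N; rewrite mulr1 expg1.
have : (D + c^-1 + 1)^-1 * S <= c * S.
  rewrite ler_wpM2r // -[leRHS]invrK lef_pV2 ?posrE //; lra.
have : c * (S - 1) <= c * m by rewrite ler_pM2l //; lra.
have : D * m <= D * (S + 1) by rewrite ler_wpM2l //; lra.
have : 0 <= c^-1 * S by rewrite mulr_ge0 // ltW.
by split; lra.
Qed.

Definition linear_orbit L E a o :=
  forall n, L * n%:R <= mdist o (act (a ^+ n)%g o) <= L * n%:R + E.

(** This makes Gromov products between points of one orbit computable up to a
    bounded error, which is what the stability of quasi-geodesics is usually
    needed for. *)
Lemma orbit_linear delta c a o :
    hyperbolic_with Y delta -> 0 < c -> drift_rate c a ->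
  exists L E, [/\ 0 < L, 0 <= E & linear_orbit L E a o].
Proof.
move=> hyp c0 ac.
apply: (linear_up_to_constant c0 (hyperbolic_with_ge0 o hyp)) => [n|p q|p q].
- exact: ac.
- exact: orbit_subadditive.
have := four_point hyp o (act (a ^+ p)%g o) (act (a ^+ (p + q))%g o)
  (act (a ^+ (p + q + p))%g o).
rewrite !orbit_dist -[in X in _ + X]addnA orbit_dist [(q + p)%N]addnC.
have twice (x : R) : x + x = 2 * x by lra.
by rewrite !twice.
Qed.

End IsometricActions.

(** * Orbits of independent loxodromic elements *)

Section IndependentAxes.
Variables (R : realType) (Y : metricType R) (G : groupType).
Variable act : G -> Y -> Y.
Hypothesis isom_act : isometric_action act.
Implicit Types (a b g w : G) (o y : Y) (c delta : R).

(** The [N + 1] elements [h i] lie in a set that acylindricity allows only [N]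
    elements, so they are not distinct. *)
Lemma acylindrical_pigeonhole r : acylindrical act -> 0 <= r ->
  exists (D : R) (N : nat), forall x y (h : nat -> G), D <= mdist x y ->
    (forall i, (i <= N)%N ->
      mdist x (act (h i) x) <= r /\ mdist y (act (h i) y) <= r) ->
  exists i j, [/\ (i < j)%N, (j <= N)%N & h i = h j].
Proof.
move=> acyl /acyl[D [N [_ few]]]; exists D, N => x y h /few fewxy hr.
apply: contrapT => noij.
have hinj : {in `I_N.+1 &, injective h}.
  move=> i j; rewrite !inE /= => iN jN hij.
  by case: (ltngtP i j) => // ij; case: noij; [exists i, j | exists j, i].
have : (`I_N.+1 #<= `I_N)%card.
  apply: card_le_trans fewxy.
  rewrite -(card_le_eql (inj_card_eq hinj)); apply: subset_card_le.
  by move=> _ [i iN <-]; exact: hr.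
by rewrite card_le_II ltnn.
Qed.

Lemma linear_orbit_product L E a o i m : linear_orbit act L E a o -> (i <= m)%N ->
  L * i%:R - E / 2 <= gromov_product o (act (a ^+ i)%g o) (act (a ^+ m)%g o).
Proof.
move=> aL /subnKC <-; rewrite /gromov_product orbit_dist // !(metric_sym _ o).
have := aL i; have := aL (i + (m - i))%N; have := aL (m - i)%N.
by rewrite natrD; lra.
Qed.

(** Seen from [o], the point [a^i o] is in the direction of [a^m o], up to
    distance [L_a i], and [b^j o] is in the direction of [b^n o].  Since these
    two directions agree up to that distance, so do those of [a^i o] and
    [b^j o], and two points in the same direction at nearly the same distance
    from [o] are close. *)
Lemma fellow_travel delta La Lb E a b o m n i j :
    hyperbolic_with Y delta -> 0 < La -> 0 < Lb ->
    linear_orbit act La E a o -> linear_orbit act Lb E b o ->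
    La * i%:R + E < gromov_product o (act (a ^+ m)%g o) (act (b ^+ n)%g o) ->
    Lb * j%:R <= La * i%:R < Lb * j%:R + Lb ->
  mdist (act (b ^+ j)%g o) (act (a ^+ i)%g o) <= Lb + 3 * E + 4 * delta.
Proof.
move=> hyp La0 Lb0 aL bL far /andP[ji ij].
have E0 : 0 <= E by have := aL 0%N; lra.
have im : (i <= m)%N.
  rewrite -(ler_nat R) -(ler_pM2l La0); have := aL m.
  have := gromov_product_lel o (act (a ^+ m)%g o) (act (b ^+ n)%g o).
  by rewrite metric_sym; lra.
have jn : (j <= n)%N.
  rewrite -(ler_nat R) -(ler_pM2l Lb0); have := bL n.
  have := gromov_product_ler o (act (a ^+ m)%g o) (act (b ^+ n)%g o).
  by rewrite metric_sym; lra.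
have aim := linear_orbit_product aL im.
have bjn := linear_orbit_product bL jn.
have ain : Lb * j%:R - E / 2 - delta <=
    gromov_product o (act (a ^+ i)%g o) (act (b ^+ n)%g o).
  apply: le_trans (hyp o _ (act (a ^+ m)%g o) _).
  by rewrite lerD2r le_min; apply/andP; split; lra.
have : Lb * j%:R - E / 2 - delta - delta <=
    gromov_product o (act (a ^+ i)%g o) (act (b ^+ j)%g o).
  apply: le_trans (hyp o _ (act (b ^+ n)%g o) _).
  rewrite lerD2r le_min ain gromov_productC /=.
  by have := hyperbolic_with_ge0 o hyp; lra.
rewrite /gromov_product !(metric_sym _ o) [mdist (act (a ^+ i)%g o) _]metric_sym.
by have := aL i; have := bL j; lra.
Qed.

(** Let [j i] be the exponent for which [b^(j i) o] is about as far from [o] as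
    [a^i o].  A large product makes [a^i o] and [b^(j i) o] close for all [i] up
    to [P + N].  As [j] is additive up to [1], the elements [b^-(j i) a^i] with
    [i <= N] almost fix both [o] and [a^P o], and acylindricity yields two
    equal ones, hence a power of [a] that is a power of [b]. *)
Lemma axes_diverge_nat delta ca cb a b o :
    hyperbolic_with Y delta -> acylindrical act ->
    0 < ca -> 0 < cb -> drift_rate act ca a -> drift_rate act cb b ->
    (forall m n, (a ^+ m)%g = (b ^+ n)%g -> m = 0%N) ->
  exists T, forall m n,
    gromov_product o (act (a ^+ m)%g o) (act (b ^+ n)%g o) <= T.
Proof.
move=> hyp acyl ca0 cb0 ac bc indep.
have delta0 := hyperbolic_with_ge0 o hyp.
have [La [Ea [La0 Ea0 aLa]]] := orbit_linear isom_act o hyp ca0 ac.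
have [Lb [Eb [Lb0 Eb0 bLb]]] := orbit_linear isom_act o hyp cb0 bc.
pose E := Ea + Eb.
have aL : linear_orbit act La E a o by move=> n; have := aLa n; rewrite /E; lra.
have bL : linear_orbit act Lb E b o by move=> n; have := bLb n; rewrite /E; lra.
have E0 : 0 <= E by rewrite addr_ge0.
clearbody E.
(* Exponents with [L_b (j i)] equal to [L_a i] up to rounding. *)
pose j i : nat := Num.truncn (La * i%:R / Lb).
have jP i : Lb * (j i)%:R <= La * i%:R < Lb * (j i)%:R + Lb.
  have /truncn_itv : 0 <= La * i%:R / Lb by rewrite divr_ge0 ?mulr_ge0 // ltW.
  rewrite -/(j i) ler_pdivlMr // ltr_pdivrMr // -[(j i).+1%:R]natr1.
  by rewrite mulrDl mul1r mulrC.
have jD i p : exists e : bool, j (i + p)%N = (j i + j p + e)%N.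
  have := jP i; have := jP p; have := jP (i + p)%N; rewrite natrD => jip jp ji.
  have lo : (j i + j p < j (i + p) + 1)%N.
    by rewrite -(ltr_nat R) -(ltr_pM2l Lb0) !natrD; lra.
  have hi : (j (i + p) < j i + j p + 2)%N.
    by rewrite -(ltr_nat R) -(ltr_pM2l Lb0) !natrD; lra.
  move: (j i + j p)%N (j (i + p)%N) lo hi => x y; clear => lo hi.
  have [->|->] : y = x \/ y = x.+1 by lia.
    by exists false; rewrite addn0.
  by exists true; rewrite addn1.
pose r := Lb + 3 * E + 4 * delta.
have r0 : 0 <= r by rewrite /r; lra.
have bo0 := mdist_ge0 o (act b o).
pose rho := 2 * r + mdist o (act b o).
have rho0 : 0 <= rho by rewrite /rho; lra.
have [D [N few]] := acylindrical_pigeonhole acyl rho0.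
pose P := Num.bound `|D / La|.
have DP : D <= mdist o (act (a ^+ P)%g o).
  have /andP[+ _] := aL P; apply: le_trans; rewrite mulrC -ler_pdivrMr //.
  by rewrite ltW // (le_lt_trans (ler_norm _)) // archi_boundP.
exists (La * (P + N)%:R + E) => m n; rewrite leNgt; apply/negP => far.
have close i : (i <= P + N)%N ->
    mdist (act (b ^+ j i)%g o) (act (a ^+ i)%g o) <= r.
  move=> iPN; apply: (fellow_travel hyp La0 Lb0 aL bL) (jP i).
  by apply: le_lt_trans far; rewrite lerD2r ler_pM2l // ler_nat.
(* The point [a^P o] is sent by [b^(j i)] close to [b^(j i + j P) o], by [a^i]
   to [a^(i + P) o], and these are close since [j] is almost additive. *)
have [|i [i' [ii' i'N]]] :=
  few o (act (a ^+ P)%g o) (fun i => b ^- (j i) * a ^+ i)%g DP.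
  move=> i iN; rewrite !actM // !mdist_actV // -!actM //; split.
    apply: le_trans (close i (leq_trans iN (leq_addl _ _))) _.
    by rewrite /rho; lra.
  rewrite -expgnDr actM //.
  have := metric_triangle (act (b ^+ j i)%g (act (a ^+ P)%g o))
    (act (b ^+ j i)%g (act (b ^+ j P)%g o)) (act (a ^+ (i + P))%g o).
  rewrite mdist_act // [mdist (act (a ^+ P)%g o) _]metric_sym.
  have := metric_triangle (act (b ^+ j i)%g (act (b ^+ j P)%g o))
    (act (b ^+ j (i + P))%g o) (act (a ^+ (i + P))%g o).
  have := close P (leq_addr _ _).
  have : (i + P <= P + N)%N by rewrite addnC leq_add2l.
  move=> /close; have [e ->] := jD i P.
  rewrite -[act (b ^+ j i)%g (act (b ^+ j P)%g o)]actM // -expgnDr orbit_dist //.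
  have : mdist o (act (b ^+ e)%g o) <= mdist o (act b o).
    by case: e; rewrite ?expg1 // expg0 act1 // mdistxx.
  by rewrite /rho; lra.
have jj : (j i <= j i')%N.
  have [e] := jD i (i' - i)%N.
  by rewrite subnKC ?(ltnW ii') // => ->; rewrite -addnA leq_addr.
move=> h; have : (a ^+ (i' - i))%g = (b ^+ (j i' - j i))%g.
  apply: (@mulIg _ (a ^+ i)%g); rewrite -expgnDr subnK ?(ltnW ii') //.
  by rewrite expgnFr // -mulgA h mulgA mulgV mul1g.
by move=> /indep/eqP; rewrite subn_eq0 leqNgt ii'.
Qed.

(** Reduces to natural exponents by replacing [a] and [b] with their inverses,
    which generate the same subgroups and have the same drift rates. *)
Lemma axes_diverge delta ca cb a b o :
    hyperbolic_with Y delta -> acylindrical act ->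
    0 < ca -> 0 < cb -> drift_rate act ca a -> drift_rate act cb b ->
    cyclic_subgroup a `&` cyclic_subgroup b = [set 1%g] ->
  exists T, forall z w : int,
    gromov_product o (act (expgz a z) o) (act (expgz b w) o) <= T.
Proof.
move=> hyp acyl ca0 cb0 ac bc indep.
have [||T _ TP] := @uniform_bound R (bool * bool)%type (fun s T => forall m n : nat,
    gromov_product o (act (signed a s.1 ^+ m)%g o)
      (act (signed b s.2 ^+ n)%g o) <= T).
- by move=> s T T' TT' PT m n; apply: le_trans TT'.
- move=> [s s']; apply: (axes_diverge_nat o hyp acyl ca0 cb0).
  1,2: exact: drift_rate_signed.
  move=> m n; rewrite !signed_expgz => ab.
  have : (cyclic_subgroup a `&` cyclic_subgroup b) (expgz a ((-1) ^+ s * m%:Z)).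
    by split; [|rewrite ab]; eexists.
  rewrite indep -signed_expgz => /= a1.
  have := drift_rate_signed isom_act s ac o m.
  rewrite a1 act1 // mdistxx pmulr_rle0 // => m0; apply/eqP.
  by rewrite -(pnatr_eq0 R) eq_le m0 /=.
by exists T => z w; rewrite !expgzE; exact: (TP (z < 0, w < 0)).
Qed.

End IndependentAxes.

(** * Products of large powers *)

Section CyclicProducts.
Variables (G : groupType) (k : nat) (k_gt0 : (0 < k)%N) (s : 'I_k -> G).

Definition cyc (n : nat) : 'I_k := Ordinal (ltn_pmod n k_gt0).

Definition partial_prod (n : nat) : G := (\prod_(0 <= i < n) s (cyc i))%g.

Lemma cycS n : cyc n.+1 = ordS (cyc n).
Proof. by apply: val_inj; rewrite /= -addn1 -modnDml addn1. Qed.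

Lemma partial_prodS n : partial_prod n.+1 = (partial_prod n * s (cyc n))%g.
Proof. by rewrite /partial_prod big_nat_recr. Qed.

Lemma partial_prod_period : partial_prod k = (\prod_(i < k) s i)%g.
Proof.
rewrite /partial_prod big_mkord; apply: eq_bigr => i _; congr s.
by apply: val_inj; rewrite /= modn_small.
Qed.

Lemma partial_prod_mul n : partial_prod (n * k) = ((\prod_(i < k) s i) ^+ n)%g.
Proof.
elim: n => [|n IHn]; first by rewrite /partial_prod big_nil.
rewrite mulSn expgS -IHn -partial_prod_period /partial_prod.
rewrite (@big_cat_nat _ _ _ k) ?leq_addr //=; congr (_ * _)%g.
rewrite -{1}[k]add0n big_addn addKn; apply: eq_bigr => i _; congr s.
by apply: val_inj; rewrite /= modnDr.
Qed.

End CyclicProducts.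

(* [ordS i] is the cyclic successor of [i] in ['I_k] *)
Theorem theorem3p9 (R : realType) (Y : metricType R) (G : groupType)
    (act : G -> Y -> Y) (k : nat) (g u : 'I_k -> G)
    (hyperbolic_Y : hyperbolic_space Y)
    (fg_G : finitely_generated G)
    (nvc_G : ~ virtually_cyclic G)
    (isom_act : isometric_action act)
    (acyl_act : acylindrical act)
    (k_gt0 : (0 < k)%N)
    (lox_u : forall i : 'I_k, loxodromic act (u i))
    (indep_u : forall i : 'I_k,
      cyclic_subgroup (u i) `&`
        conj_set (g (ordS i)) (cyclic_subgroup (u (ordS i))) = [set 1%g]) :
  exists M : int, 0 < M /\
    forall t : 'I_k -> int, (forall i : 'I_k, M <= `|t i|) ->
      loxodromic act (phi g u t).
Proof.
have [_ [delta [_ hyp]]] := hyperbolic_Y.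
have [gamma _] := lox_u (Ordinal k_gt0).
pose o := gamma 0.
have drift i : exists c, 0 < c /\ drift_rate act c (u i).
  by have [c c0 uc] := loxodromic_drift isom_act (lox_u i); exists c.
have [c cP] := choice drift.
have c0 i : 0 < c i by case: (cP i).
have uc i : drift_rate act (c i) (u i) by case: (cP i).
pose v i := (g i * u i * (g i)^-1)%g.
have [|i|C C0 CP] := @uniform_bound R 'I_k (fun i C =>
    mdist o (act (g i) o) <= C /\ forall z w : int,
      gromov_product o (act (expgz (u i) z) o) (act (expgz (v (ordS i)) w) o) <= C).
- move=> i C C' CC' [gC PC]; split; first exact: le_trans CC'.
  by move=> z w; apply: le_trans CC'.
- have uv : cyclic_subgroup (u i) `&` cyclic_subgroup (v (ordS i)) = [set 1%g].
    by rewrite -conj_cyclic_subgroup indep_u.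
  have vc := drift_rate_conj isom_act (g (ordS i)) (uc (ordS i)).
  have [T TP] := axes_diverge isom_act o hyp acyl_act (c0 i) (c0 _) (uc i) vc uv.
  exists (Num.max (mdist o (act (g i) o)) T); rewrite le_max lexx; split => // z w.
  by rewrite le_max TP orbT.
(* Corners will be bounded by [3 C], so that sides must have length at least
   [2 (3 C + delta) + 1]; moving by [g i] costs another [C]. *)
pose K := 2 * (3 * C + delta) + 1 + C.
have [|i|M M0 MP] := @uniform_bound R 'I_k (fun i M => K <= c i * M).
- by move=> i M M' MM' KM; apply: le_trans KM _; rewrite ler_pM2l.
- by exists (K / c i); rewrite mulrC divfK // gt_eqF.
exists (Num.bound M).+1%:Z; split=> // t tM.
pose s i := (g i * expgz (u i) (t i))%g.
pose x n := act (partial_prod k_gt0 s n) o.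
have xS n : x n.+1 = act (partial_prod k_gt0 s n) (act (s (cyc k_gt0 n)) o).
  by rewrite /x partial_prodS actM.
have long i : 2 * (3 * C + delta) + 1 <= mdist o (act (s i) o).
  have tiM : M <= `|t i|%:~R.
    have := tM i; rewrite -(ler_int R); apply: le_trans.
    apply: ltW; apply: lt_trans (archi_boundP M0) _.
    by rewrite -[X in _ < X]pmulrn ltr_nat.
  have := drift_rate_expgz isom_act (t i) o (uc i).
  have : c i * M <= c i * `|t i|%:~R by rewrite ler_pM2l.
  have := MP i; have [gC _] := CP i; rewrite /K.
  have := metric_triangle (act (g i) o) o (act (s i) o).
  rewrite /s actM // mdist_act // [mdist (act (g i) o) o]metric_sym; lra.
(* Replacing [(g u^t)^-1 o] by [u^-t o] and [g' u'^t' o] by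
   [g' u'^t' g'^-1 o] turns the corner into a product between two orbits, with
   an error of at most [C] on each side. *)
have turn i : gromov_product o (act (s i)^-1%g o) (act (s (ordS i)) o) <= 3 * C.
  have left_error :
      mdist (act (s i)^-1%g o) (act (expgz (u i) (- t i)) o) <= C.
    rewrite expgzN invgM actM // mdist_act // metric_sym mdist_actV // metric_sym.
    by have [] := CP i.
  have right_error :
      mdist (act (s (ordS i)) o) (act (expgz (v (ordS i)) (t (ordS i))) o) <= C.
    rewrite conj_expgz (actM isom_act (s (ordS i))) mdist_act // mdist_actV //.
    by rewrite metric_sym; have [] := CP (ordS i).
  have [_ /(_ (- t i) (t (ordS i))) bounded] := CP i.
  have := gromov_product_movel o (act (s i)^-1%g o) (act (expgz (u i) (- t i)) o)
    (act (s (ordS i)) o).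
  have := gromov_product_mover o (act (expgz (u i) (- t i)) o)
    (act (s (ordS i)) o) (act (expgz (v (ordS i)) (t (ordS i))) o).
  by lra.
have x_turn n : gromov_product (x n.+1) (x n) (x n.+2) <= 3 * C.
  have -> : x n = act (partial_prod k_gt0 s n.+1) (act (s (cyc k_gt0 n))^-1%g o).
    by rewrite -actM // partial_prodS mulgK.
  have := turn (cyc k_gt0 n).
  by rewrite -cycS -(gromov_product_act isom_act (partial_prod k_gt0 s n.+1)) -xS.
have x_long n : 2 * (3 * C + delta) + 1 <= mdist (x n) (x n.+1).
  by rewrite xS mdist_act // long.
apply: (@drift_loxodromic _ _ _ _ isom_act 1 _ o) => //.
apply: (@drift_rate_of_orbit _ _ _ _ isom_act _ 0 _ o) => n.
have := local_to_global hyp x_turn x_long (n * k).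
rewrite mul1r subr0 /x partial_prod_mul /partial_prod big_nil act1 //.
by apply: le_trans; rewrite ler_nat leq_pmulr.
Qed.
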